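(* Let $G'\subset\Omega\subset G$ be a domain. Scalar functions $F_1,\ldots,F_k$ on $G'$ form a basis of first integrals on $G'$ for the Pfaff system of equations $$\omega_j(x)=0,\qquad j=1,\ldots,m,$$ with $\omega_j\in C(G)$, $j=1,\ldots,m$, if and only if $F_1,\ldots,F_k$ form a basis of first integrals on $G'$ for the contragredient linear homogeneous system of partial differential equations $$\mathfrak G_\zeta(x)\,y=0,\qquad \zeta=m+1,\ldots,n.$$
   Context: A domain is an open arcwise connected set. $G\subset\mathbb R^n$ is a domain, $m\le n$, and $\omega_j(x)=\sum_{i=1}^n w_{ji}(x)\,dx_i$, $j=1,\ldots,m$, are linear differential forms on $G$ with continuous coefficients which are not linearly bound on $G$. (1-forms are linearly bound on $G$ if they are linearly dependent at every point of $G$; ''not linearly bound'' is used in the sense that the coefficient matrix has full rank almost everywhere on $G$.) Contragredient system: add $n-m$ linear differential forms $\omega_\zeta(x)=\sum_{i=1}^n w_{\zeta i}(x)\,dx_i$, $\zeta=m+1,\ldots,n$, with $w_{\zeta i}\in C(G)$, such that $\omega_1,\ldots,\omega_n$ are not linearly bound on $G$. Let $\Omega\subset G$ be a domain whose complement in $G$ has measure zero and on which the $n\times n$ matrix $\widetilde w(x)=\|w_{\xi i}(x)\|$ is nonsingular, and let $g(x)=\|g_{i\xi}(x)\|=\widetilde w(x)^{-1}$ on $\Omega$. Put $\mathfrak G_i(x)=\sum_{\xi=1}^n g_{\xi i}(x)\,\partial_{x_\xi}$ for $x\in\Omega$, $i=1,\ldots,n$. A first integral of the Pfaff system on a domain $G'\subset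 G$ is a function $F\in C^1(G')$ for which there exist $a_j\in C(G')$, $j=1,\ldots,m$, with $dF(x)=\sum_{j=1}^m a_j(x)\,\omega_j(x)$ for all $x\in G'$. A first integral on $G'$ of $\mathfrak G_\zeta y=0$, $\zeta=m+1,\ldots,n$, is a function $F\in C^1(G')$ with $\mathfrak G_\zeta F(x)=0$ for all $x\in G'$ and all $\zeta$. For either system, a basis of first integrals on $G'$ (of dimension $k$) is a set of functionally independent first integrals $F_1,\ldots,F_k$ on $G'$ such that every first integral $\Psi$ on $G'$ has the form $\Psi(x)=\Phi(F_1(x),\ldots,F_k(x))$ for all $x\in G'$, where $\Phi$ is some function of class $C^1(\mathrm EF)$ and $\mathrm EF\subset\mathbb R^k$ is the range of $(F_1,\ldots,F_k)$. Functionally independent means that the Jacobi matrix of $(F_1,\ldots,F_k)$ has rank $k$ almost everywhere on $G'$. *)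

(* Defs.v *)
From HB Require Import structures.
From mathcomp Require Import all_boot all_order all_algebra.
From mathcomp Require Import all_classical all_reals all_analysis.

Set Implicit Arguments.
Unset Strict Implicit.
Unset Printing Implicit Defensive.

Import Order.TTheory GRing.Theory Num.Theory.
Import numFieldNormedType.Exports.

Local Open Scope classical_set_scope.
Local Open Scope ring_scope.

(* Functions on a subset A of R^n are represented by total functions on
   'rV[R]_n, of which only the values on A matter: every use of the notions
   below at an open set A depends only on the restriction to A. *)

Section Domains.
Context {R : realType} {n : nat}.
Implicit Types A G : set 'rV[R]_n.

Definition arcwise_connected A : Prop :=
  forall x y, A x -> A y ->
    exists gamma : R -> 'rV[R]_n,
      [/\ {within `[0, 1], continuous gamma}, gamma 0 = x, gamma 1 = y
        & forall t : R, 0 <= t <= 1 -> A (gamma t)].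

Definition is_domain G : Prop := open G /\ arcwise_connected G.

(* The library has no Lebesgue measure on R^n; A is null when countably many
   closed boxes of arbitrarily small total volume cover it. As usual, A is not
   required to be measurable. Meant for n > 0: in R^0 every box has volume 1. *)
Definition lebesgue_null A : Prop :=
  forall e : R, 0 < e ->
    exists a b : nat -> 'rV[R]_n,
      [/\ forall l i, a l 0 i <= b l 0 i,
          A `<=` \bigcup_l
              [set x : 'rV[R]_n | forall i, a l 0 i <= x 0 i <= b l 0 i]
        & (\sum_(0 <= l <oo) (\prod_(i < n) (b l 0 i - a l 0 i))%:E <= e%:E)%E].

Definition ae_on G (P : 'rV[R]_n -> Prop) : Prop :=
  lebesgue_null [set x | G x /\ ~ P x].

Definition partial (i : 'I_n) (f : 'rV[R]_n -> R) (x : 'rV[R]_n) : R :=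
  'D_(delta_mx 0 i) f x.

(* Meant for open G. *)
Definition C1 G (f : 'rV[R]_n -> R) : Prop :=
  (forall x, G x -> differentiable f x) /\
  (forall i, {within G, continuous (partial i f)}).

End Domains.

Section Forms.
Context {R : realType} {n : nat}.
Implicit Types G : set 'rV[R]_n.

(* A family of p linear differential forms on R^n is given by its p x n matrix
   of coefficients; dx_i is the i-th coordinate function of the vector v. *)
Definition diff_form p (w : 'rV[R]_n -> 'M[R]_(p, n)) (j : 'I_p)
    (x v : 'rV[R]_n) : R :=
  \sum_(i < n) w x j i * v 0 i.

Definition forms_continuous p G (w : 'rV[R]_n -> 'M[R]_(p, n)) : Prop :=
  forall j i, {within G, continuous (fun x => w x j i)}.

Definition not_linearly_bound p G (w : 'rV[R]_n -> 'M[R]_(p, n)) : Prop :=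
  ae_on G (fun x => \rank (w x) = p).

(* F is a first integral of the system w_1 = ... = w_m = 0. *)
Definition pfaff_first_integral m G (w : 'rV[R]_n -> 'M[R]_(m, n))
    (F : 'rV[R]_n -> R) : Prop :=
  C1 G F /\
  exists a : 'I_m -> 'rV[R]_n -> R,
    (forall j, {within G, continuous (a j)}) /\
    (forall x, G x -> forall v : 'rV[R]_n,
       'd F x v = \sum_(j < m) a j x * diff_form w j x v).

(* The forms wt complete the m forms w to n forms. *)
Definition completes m (hmn : (m <= n)%N) G
    (w : 'rV[R]_n -> 'M[R]_(m, n)) (wt : 'rV[R]_n -> 'M[R]_n) : Prop :=
  forall x, G x -> forall (j : 'I_m) i, wt x (widen_ord hmn j) i = w x j i.

Definition contragredient_op (wt : 'rV[R]_n -> 'M[R]_n) (i : 'I_n)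
    (y : 'rV[R]_n -> R) (x : 'rV[R]_n) : R :=
  \sum_(xi < n) invmx (wt x) xi i * partial xi y x.

(* The indices m+1, ..., n are the zeta : 'I_n with m <= zeta, since 'I_n
   counts from 0. *)
Definition contragredient_first_integral m G (wt : 'rV[R]_n -> 'M[R]_n)
    (F : 'rV[R]_n -> R) : Prop :=
  C1 G F /\
  forall x, G x -> forall zeta : 'I_n, (m <= zeta)%N ->
    contragredient_op wt zeta F x = 0.

Definition joint k (F : 'I_k -> 'rV[R]_n -> R) (x : 'rV[R]_n) : 'rV[R]_k :=
  \row_(i < k) F i x.

Definition functionally_independent k G (F : 'I_k -> 'rV[R]_n -> R) : Prop :=
  ae_on G (fun x => \rank ('J (joint F) x) = k).

(* The range of F need not be open; being of class C^1 on it means being of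
   class C^1 on an open set containing it. *)
Definition is_basis k G (first_integral : ('rV[R]_n -> R) -> Prop)
    (F : 'I_k -> 'rV[R]_n -> R) : Prop :=
  [/\ forall i, first_integral (F i),
      functionally_independent G F
    & forall Psi, first_integral Psi ->
        exists (U : set 'rV[R]_k) (Phi : 'rV[R]_k -> R),
          [/\ open U, joint F @` G `<=` U, C1 U Phi
            & forall x, G x -> Psi x = Phi (joint F x)]].

End Forms.

(* Main.v *)
(** Where [wt] is invertible, [G_i F] is the [i]-th coordinate of [dF] in the
    coframe given by the rows of [wt].  So [dF] is a combination of the first
    [m] forms exactly when [G_zeta F = 0] for the remaining indices, and the
    coefficients [G_j F] are then continuous by Cramer's rule.  The two systems
    thus have the same first integrals, hence the same bases. *)
Require Import Defs.
From HB Require Import structures.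
From mathcomp Require Import all_boot all_order all_algebra.
From mathcomp Require Import all_classical all_reals all_analysis.

Set Implicit Arguments.
Unset Strict Implicit.
Unset Printing Implicit Defensive.

Import Order.TTheory GRing.Theory Num.Theory.
Import numFieldNormedType.Exports.

Local Open Scope classical_set_scope.
Local Open Scope ring_scope.

Section MatrixLimits.
Context {K : realType} {T : Type} {D : set_system T} {FD : Filter D}.

(** The Leibniz expansion is a polynomial in the entries. The filter is arbitrary so that limits
    within a subset are covered. *)
Lemma cvg_det n (f : T -> 'M[K]_n) (A : 'M[K]_n) :
  (forall i j, f x i j @[x --> D] --> A i j) ->
  \det (f x) @[x --> D] --> \det A.
Proof.
move=> fA; apply: cvg_big => [|s _]; first exact: add_continuous.
apply: cvgM; first exact: cvg_cst.
by apply: cvg_big => [|i _]; [exact: mul_continuous | exact: fA].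
Qed.

Lemma cvg_adjugate n (f : T -> 'M[K]_n) (A : 'M[K]_n) i j :
  (forall i j, f x i j @[x --> D] --> A i j) ->
  (\adj (f x)) i j @[x --> D] --> (\adj A) i j.
Proof.
move=> fA; rewrite mxE.
under eq_cvg do rewrite mxE.
apply: cvgM; first exact: cvg_cst.
apply: cvg_det => k l; rewrite !mxE.
by under eq_cvg do rewrite !mxE; exact: fA.
Qed.

Lemma cvg_invmx n (f : T -> 'M[K]_n) (A : 'M[K]_n) i j :
  A \in unitmx -> (forall i j, f x i j @[x --> D] --> A i j) ->
  invmx (f x) i j @[x --> D] --> invmx A i j.
Proof.
move=> uA fA.
have detA0 : \det A != 0 by rewrite -unitfE -unitmxE.
have detf := cvg_det fA.
have -> : invmx A i j = (\det A)^-1 * (\adj A) i j by rewrite /invmx uA mxE.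
(* [invmx] returns a singular matrix unchanged, so Cramer's formula for [f x] is available only
   eventually, once [\det (f x)] is nonzero. *)
apply: (@cvg_trans _ ((\det (f x))^-1 * (\adj (f x)) i j @[x --> D])).
  apply: near_eq_cvg; near=> x.
  have det0 : \det (f x) != 0 by near: x; apply: (cvgr_neq0 _ detf).
  by rewrite /invmx unitmxE unitfE det0 !mxE.
by apply: cvgM; [exact: cvgV | exact: cvg_adjugate].
Unshelve. all: by end_near. Qed.

End MatrixLimits.

Section FirstIntegrals.
Context {R : realType} {n : nat}.
Implicit Types (G : set 'rV[R]_n) (F : 'rV[R]_n -> R).

Definition gradient F (x : 'rV[R]_n) : 'rV[R]_n := \row_i partial i F x.

Lemma diff_gradient F x v : differentiable F x ->
  'd F x v = \sum_i gradient F x 0 i * v 0 i.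
Proof.
move=> dF; rewrite {1}(row_sum_delta v) linear_sum; apply: eq_bigr => i _.
by rewrite linearZ /= mxE /partial deriveE // mulrC.
Qed.

Lemma contragredient_opE (wt : 'rV[R]_n -> 'M[R]_n) F x i :
  contragredient_op wt i F x = (gradient F x *m invmx (wt x)) 0 i.
Proof. by rewrite mxE; apply: eq_bigr => l _; rewrite mxE mulrC. Qed.

(** Provides the continuity that a first integral of the Pfaff system demands of its
    coefficients. *)
Lemma contragredient_op_continuous G (wt : 'rV[R]_n -> 'M[R]_n) F i :
  forms_continuous G wt -> (forall x, G x -> wt x \in unitmx) -> C1 G F ->
  {within G, continuous (contragredient_op wt i F)}.
Proof.
move=> cwt uwt [_ cF]; apply/subspace_continuousP => x Gx.
apply: cvg_big => [|l _]; first exact: add_continuous.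
apply: cvgM; last by have /subspace_continuousP := cF l; apply.
apply: cvg_invmx => [|a b]; first exact: uwt.
by have /subspace_continuousP := cwt a b; apply.
Qed.

(** Exchanging the two sums turns a combination of forms into a row-by-matrix product. *)
Lemma sum_diff_form m (w : 'rV[R]_n -> 'M[R]_(m, n)) (a : 'rV[R]_m) x v :
  \sum_(j < m) a 0 j * diff_form w j x v = \sum_i (a *m w x) 0 i * v 0 i.
Proof.
rewrite /diff_form; under eq_bigr do rewrite mulr_sumr.
rewrite exchange_big; apply: eq_bigr => i _; rewrite mxE mulr_suml.
by apply: eq_bigr => j _; rewrite mulrA.
Qed.

(** Only the first [m] rows of [wt x] meet nonzero entries of [c], and these are the rows of
    [w x]. *)
Lemma mulmx_completes m (hmn : (m <= n)%N) G
    (w : 'rV[R]_n -> 'M[R]_(m, n)) (wt : 'rV[R]_n -> 'M[R]_n) (c : 'rV[R]_n) x :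
  completes hmn G w wt -> G x -> (forall i : 'I_n, (m <= i)%N -> c 0 i = 0) ->
  c *m wt x = (\row_j c 0 (widen_ord hmn j)) *m w x.
Proof.
move=> ext Gx c0; apply/rowP => l; rewrite !mxE.
rewrite (bigID (fun i : 'I_n => (i < m)%N)) /= [X in _ + X]big1 ?addr0; last first.
  by move=> i; rewrite -leqNgt => /c0 ->; rewrite mul0r.
by rewrite (big_ord_narrow hmn); apply: eq_bigr => j _; rewrite mxE ext.
Qed.

Lemma pfaff_contragredient m (hmn : (m <= n)%N) G
    (w : 'rV[R]_n -> 'M[R]_(m, n)) (wt : 'rV[R]_n -> 'M[R]_n) F :
  completes hmn G w wt -> forms_continuous G wt ->
  (forall x, G x -> wt x \in unitmx) ->
  pfaff_first_integral G w F <-> contragredient_first_integral m G wt F.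
Proof.
move=> ext cwt uwt; split=> -[C1F]; have [dF _] := C1F.
- move=> [a [_ da]]; split=> // x Gx z mz; rewrite contragredient_opE.
  (* The coefficients [a] at [x], padded with zeros to length [n]; [insub] tests whether the index
     is below [m]. *)
  pose c : 'rV[R]_n := \row_i
    if insub (val i) is Some j then a (j : 'I_m) x else 0.
  have c0 (i : 'I_n) : (m <= i)%N -> c 0 i = 0.
    by move=> mi; rewrite mxE insubN // -leqNgt.
  (* Since [wt x] is invertible, this identity makes [c] the coordinate row of dF, whose entries
     vanish from [m] on. *)
  suff -> : gradient F x = c *m wt x by rewrite mulmxK ?uwt ?c0.
  rewrite (mulmx_completes ext Gx c0); apply/rowP => i.
  (* Evaluating both sides on the [i]-th basis vector extracts the [i]-th partial derivative. *)
  have := da x Gx (delta_mx 0 i); rewrite -deriveE; last exact: dF.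
  rewrite [gradient F x 0 i]mxE /partial => ->.
  under eq_bigr => j _.
    have -> : a j x = (\row_j c 0 (widen_ord hmn j)) 0 j.
      rewrite !mxE /= insubT //= => jm; congr a; exact: val_inj.
    over.
  rewrite sum_diff_form (bigD1 i) //= [delta_mx _ _ _ _]mxE !eqxx mulr1 big1 ?addr0 // => l li.
  by rewrite [delta_mx _ _ _ _]mxE (negPf li) andbF mulr0.
- move=> op0; split=> //.
  (* The coefficients are the first [m] coordinates of dF in the coframe; the others vanish by
     [op0]. *)
  exists (fun j => contragredient_op wt (widen_ord hmn j) F); split=> [j|x Gx v].
    exact: contragredient_op_continuous.
  pose c := gradient F x *m invmx (wt x).
  have c0 (i : 'I_n) : (m <= i)%N -> c 0 i = 0.
    by move=> mi; rewrite -contragredient_opE op0.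
  rewrite diff_gradient; last exact: dF.
  have -> : gradient F x = c *m wt x by rewrite mulmxKV ?uwt.
  rewrite (mulmx_completes ext Gx c0) -sum_diff_form.
  by apply: eq_bigr => j _; rewrite mxE -contragredient_opE.
Qed.

End FirstIntegrals.

(** A basis depends on the system only through its predicate of first integrals, and extensionality
    identifies equivalent predicates. *)
Lemma eq_is_basis (R : realType) (n k : nat) (G : set 'rV[R]_n)
    (P Q : ('rV[R]_n -> R) -> Prop) (F : 'I_k -> 'rV[R]_n -> R) :
  (forall f, P f <-> Q f) -> is_basis G P F <-> is_basis G Q F.
Proof. by move=> PQ; have -> : P = Q by apply/funext => f; apply/propext. Qed.

Theorem theorem4p3 (R : realType) (n m k : nat) (hn : (0 < n)%N)
    (hmn : (m <= n)%N) (G Omega G' : set 'rV[R]_n)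
    (w : 'rV[R]_n -> 'M[R]_(m, n)) (wt : 'rV[R]_n -> 'M[R]_n)
    (F : 'I_k -> 'rV[R]_n -> R)
    (hG : is_domain G)
    (hwC : forms_continuous G w) (hw : not_linearly_bound G w)
    (hwt_ext : completes hmn G w wt)
    (hwtC : forms_continuous G wt) (hwt : not_linearly_bound G wt)
    (hOmega : is_domain Omega) (hOmegaG : Omega `<=` G)
    (hOmega0 : lebesgue_null (G `\` Omega))
    (hOmega_unit : forall x, Omega x -> wt x \in unitmx)
    (hG' : is_domain G') (hG'Omega : G' `<=` Omega) :
  is_basis G' (pfaff_first_integral G' w) F <->
  is_basis G' (contragredient_first_integral m G' wt) F.
Proof.
have G'G x : G' x -> G x by move=> /hG'Omega /hOmegaG.
(* It remains to restrict to [G']: completion and continuity come from [G], invertibility at every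
   point from [Omega]. *)
apply: eq_is_basis => f; apply: pfaff_contragredient.
- by move=> x /G'G; exact: hwt_ext.
- move=> i j; apply: continuous_subspaceW (hwtC i j); exact: G'G.
- by move=> x /hG'Omega; exact: hOmega_unit.
Qed.
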